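(* Let $X$ be a compact metrizable space and let $\mathcal{N}$ be a weak$^*$ closed subset of the space $\mathcal{M}(X)$ of Borel probability measures on $X$. Suppose that $\mathcal{N}$ consists of atomless measures and that $X$ has the $\mathcal{N}$-SBP. Let $A_0$ and $A_1$ be disjoint closed subsets of $X$. Then there is a continuous function $f: X\rightarrow [0,1]$ such that $f=t$ on $A_t$ for $t\in\{0,1\}$ and $f^{-1}(t)\setminus (A_0\cup A_1)$ is $\mathcal{N}$-small for all $t\in[0,1]$.
   Context: $\mathcal{M}(X)$ carries the weak$^*$ topology. A Borel subset $B$ of $X$ is $\mathcal{N}$-small if $\sup_{\mu\in\mathcal{N}}\mu(B)=0$, i.e. $\mu(B)=0$ for every $\mu\in\mathcal{N}$ (vacuously true if $\mathcal{N}=\emptyset$). The space $X$ has the $\mathcal{N}$-SBP ($\mathcal{N}$-small boundary property) if there is a basis for its topology consisting of open sets whose boundary is $\mathcal{N}$-small. A Borel probability measure on $X$ is atomless if every singleton has measure zero. The sets $A_0,A_1$ are allowed to be empty. *)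

(* Defs.v *)
From HB Require Import structures.
From mathcomp Require Import all_boot all_order all_algebra.
From mathcomp Require Import all_classical all_reals all_analysis.

Set Implicit Arguments.
Unset Strict Implicit.
Unset Printing Implicit Defensive.

Import Order.TTheory GRing.Theory Num.Theory.
Import numFieldNormedType.Exports.

Local Open Scope classical_set_scope.
Local Open Scope ring_scope.

Definition metrizable (R : realType) (X : topologicalType) : Prop :=
  exists d : X -> X -> R,
    [/\ forall x, d x x = 0,
        forall x y, d x y = 0 -> x = y,
        forall x y, d x y = d y x,
        forall x y z, d x z <= d x y + d y z
      & forall x (A : set X),
          nbhs x A <-> exists2 e : R, 0 < e & [set y | d x y < e] `<=` A].

(* Library measurable spaces are pointed, hence [ptopologicalType]. *)
Notation borel X := (g_sigma_algebraType (@open X)).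

(* The weak* topology is the coarsest one making every evaluation
   [mu |-> \int f dmu], [f : X -> R] continuous, continuous: it is induced from
   the product topology on [R ^ C(X)].  It is meant for compact [X], where each
   such [f] is integrable. *)
Definition weak_star_eval (R : realType) (X : ptopologicalType)
    (mu : probability (borel X) R) :
    {ptws {f : X -> R | continuous f} -> R} :=
  fun f => \int[mu]_x sval f x.

Definition weak_star (R : realType) (X : ptopologicalType) : topologicalType :=
  initial_topology (@weak_star_eval R X).

(* Vacuous for [N = set0], which is why no [ereal_sup] appears: the supremum of
   the empty set is [-oo] in the extended reals. *)
Definition small (R : realType) (X : ptopologicalType)
    (N : set (probability (borel X) R)) (B : set X) : Prop :=
  @measurable _ (borel X) B /\ forall mu, N mu -> mu B = 0%E.

Definition boundary (X : topologicalType) (A : set X) : set X :=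
  closure A `\` A°.

Definition small_boundary_property (R : realType) (X : ptopologicalType)
    (N : set (probability (borel X) R)) : Prop :=
  exists2 B : set (set X), basis B & forall U, B U -> small N (boundary U).

Definition atomless (R : realType) (X : ptopologicalType)
    (mu : probability (borel X) R) : Prop :=
  forall x : X, mu [set x] = 0%E.

(* Main.v *)
Require Import Defs.
From HB Require Import structures.
From mathcomp Require Import all_boot all_order all_algebra.
From mathcomp Require Import all_classical all_reals all_analysis.
From mathcomp Require Import ring lra.

Set Implicit Arguments.
Unset Strict Implicit.
Unset Printing Implicit Defensive.

Import Order.TTheory GRing.Theory Num.Theory.
Import numFieldNormedType.Exports.

Local Open Scope classical_set_scope.
Local Open Scope ring_scope.

(** The function is built as a uniform limit of Urysohn functions for the
    pair [A0], [A1].  Let [K n] be an exhaustion of the complement of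
    [A0 `|` A1] by closed sets.  Stage [n] perturbs the current function within
    the tolerance left by the earlier stages, and fixes a tolerance for the
    later ones, such that every function within that tolerance of the perturbed
    one has level sets of measure at most [1 / n.+1] in [K n], for all measures
    of [N] at once ([small_level_step]).  Since [K m `<=` K n] for [m <= n], each
    level set of the limit meets each [K m] in a null set.

    For the perturbation, cover [K n] by finitely many open sets with small
    boundary, each of small measure and on which the current function oscillates
    little, and make them disjoint at the price of discarding their boundaries,
    whose union is a closed null set.  Choose an open neighborhood [U] of that null set of
    small measure, and let the new function take distinct constant values on
    the compact pieces that remain outside [U]: a level set of any close enough
    function then lies in [U] and a single piece.

    Both occurrences of small measure must be uniform over [N].  They follow
    from [small_neighborhood]: a closed set that is null for all measures of
    [N] has open neighborhoods whose measure is uniformly small.  This is where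
    compactness of the space of probabilities enters ([weak_star_compact]).
    Limits of integrals along an ultrafilter form a positive functional of norm
    1, and such a functional is integration against a probability
    ([riesz_representation]).  The latter is obtained by the Caratheodory
    construction from the outer measure of [A] defined as the infimum of the
    bounds of the functional on monotone sequences of continuous functions that
    are eventually at least 1 on [A]. *)

(** * Separation in metrizable spaces *)

Section metrizable_separation.
Variables (R : realType) (X : ptopologicalType).
Hypothesis X_metrizable : metrizable R X.

(** The function is the distance to [F]; the constant 1 when [F] is empty. *)
Lemma closed_zero_set (F : set X) : closed F ->
  exists phi : X -> R,
    [/\ continuous phi, forall x, 0 <= phi x & forall x, F x <-> phi x = 0].
Proof.
move=> Fcl; have [d [d0 dsep dC dtri dnbhs]] := X_metrizable.
have dge0 x y : 0 <= d x y.
  by have := dtri x y x; rewrite d0 (dC y x) -mulr2n pmulrn_lge0.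
have [->|/set0P[a0 Fa0]] := eqVneq F set0.
  exists (fun=> 1); split => // [x|x]; first exact: cvg_cst.
  by split=> // /eqP; rewrite oner_eq0.
pose S x := [set d x a | a in F].
have S0 x : S x !=set0 by exists (d x a0), a0.
have Slb x : has_lbound (S x) by exists 0 => _ [a _ <-].
have infle x a : F a -> inf (S x) <= d x a.
  by move=> Fa; apply: ge_inf => //; exists a.
have inf_lip x y : inf (S x) - inf (S y) <= d x y.
  rewrite lerBlDl -lerBlDr; apply: lb_le_inf => // _ [a Fa <-].
  rewrite lerBlDr (le_trans (infle _ _ Fa))//.
  by rewrite addrC; exact: dtri.
exists (fun x => inf (S x)); split => [x|x|x].
- apply/cvgrPdist_lt => e e0; apply/dnbhs; exists e => // y /= dxy.
  by rewrite ltr_norml ltrNl opprB !(le_lt_trans (inf_lip _ _))// dC.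
- by apply: lb_le_inf => // _ [a _ <-].
- split=> [Fx|infS0].
    apply/eqP; rewrite eq_le -{1}(d0 x) infle//=.
    by apply: lb_le_inf => // _ [a _ <-].
  apply: Fcl => B /dnbhs[e e0 sB].
  have [_ [a Fa <-] dxa] := inf_adherent e0 (conj (S0 x) (Slb x)).
  by exists a; split => //; apply: sB => /=; rewrite infS0 add0r in dxa.
Qed.

Lemma metrizable_closed1 (x : X) : closed [set x].
Proof.
have [d [d0 dsep dC dtri dnbhs]] := X_metrizable => y ycl; apply: dsep.
apply/eqP; rewrite eq_le; apply/andP; split; last first.
  by have := dtri y x y; rewrite d0 (dC x y) -mulr2n pmulrn_lge0.
rewrite leNgt; apply/negP => dyx.
have [] := ycl [set z | d y z < d y x]; first by apply/dnbhs; exists (d y x).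
by move=> _ [-> /=]; rewrite ltxx.
Qed.

Lemma bump_function (L W : set X) : closed L -> open W -> L `<=` W ->
  exists u : X -> R, [/\ continuous u, forall x, 0 <= u x <= 1,
    forall x, L x -> u x = 1 & forall x, ~ W x -> u x = 0].
Proof.
move=> Lcl Wop LW; have [b [bc b0 bL]] := closed_zero_set Lcl.
have [a [ac a0 aW]] := closed_zero_set (open_closedC Wop).
have ab x : 0 < a x + b x.
  rewrite lt_neqAle addr_ge0// andbT eq_sym paddr_eq0//.
  by apply/negP => /andP[/eqP/aW nWx /eqP/bL Lx]; apply: nWx; exact: LW.
exists (fun x => a x / (a x + b x)); split => [x|x|x Lx|x nWx].
- apply: cvgM; first exact: ac.
  by apply: cvgV; [rewrite gt_eqF|apply: cvgD; [exact: ac|exact: bc]].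
- by rewrite divr_ge0// ?(ltW (ab x))//= ler_pdivrMr// mul1r lerDl.
- by have := ab x; rewrite ((bL x).1 Lx) addr0 => ax; rewrite divff// gt_eqF.
- by rewrite ((aW x).1 nWx) mul0r.
Qed.

End metrizable_separation.

(** * Positive linear functionals and their representing measures *)

(** A positive linear functional of norm 1 on the continuous functions;
    nothing is assumed about its values on other functions. *)
Record positive_functional (R : realType) (X : topologicalType)
    (Lam : (X -> R) -> R) : Prop := PositiveFunctional {
  functionalD : forall f g : X -> R, continuous f -> continuous g ->
    Lam (fun x => f x + g x) = Lam f + Lam g;
  functionalZ : forall (c : R) (f : X -> R), continuous f ->
    Lam (fun x => c * f x) = c * Lam f;
  functional_ge0 : forall f : X -> R, continuous f -> (forall x, 0 <= f x) ->
    0 <= Lam f;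
  functional1 : Lam (fun=> 1) = 1 }.

Section positive_functional_theory.
Variables (R : realType) (X : topologicalType) (Lam : (X -> R) -> R).
Hypothesis Lam_pos : positive_functional Lam.

Lemma continuous_scale (c : R) (f : X -> R) :
  continuous f -> continuous (fun x => c * f x).
Proof. by move=> fc x; apply: cvgM; [exact: cvg_cst|exact: fc]. Qed.

Lemma functionalB (f g : X -> R) : continuous f -> continuous g ->
  Lam (fun x => f x - g x) = Lam f - Lam g.
Proof.
move=> fc gc; have gNc := continuous_scale (c := -1) gc.
rewrite -[- Lam g]mulN1r -functionalZ// -functionalD//.
by congr Lam; apply/funext => x; rewrite mulN1r.
Qed.

Lemma le_functional (f g : X -> R) : continuous f -> continuous g ->
  (forall x, f x <= g x) -> Lam f <= Lam g.
Proof.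
move=> fc gc fg; rewrite -subr_ge0 -functionalB//.
apply: functional_ge0 => // [x|x]; last by rewrite subr_ge0.
by apply: cvgB; [exact: gc|exact: fc].
Qed.

Lemma functional_cst (c : R) : Lam (fun=> c) = c.
Proof.
have c1 : continuous (fun _ : X => 1 : R) by exact: cst_continuous.
have := functionalZ Lam_pos c c1.
rewrite (functional1 Lam_pos) mulr1 => {2}<-.
by congr Lam; apply/funext => x; rewrite mulr1.
Qed.

Lemma continuous_sum (I : Type) (s : seq I) (F : I -> X -> R) :
  (forall i, continuous (F i)) -> continuous (fun x => \sum_(i <- s) F i x).
Proof.
move=> Fc; elim: s => [|i s IHs] x.
  by under eq_fun do rewrite big_nil; exact: cvg_cst.
by under eq_fun do rewrite big_cons; apply: cvgD; [exact: Fc|exact: IHs].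
Qed.

Lemma functional_sum (I : Type) (s : seq I) (F : I -> X -> R) :
  (forall i, continuous (F i)) ->
  Lam (fun x => \sum_(i <- s) F i x) = \sum_(i <- s) Lam (F i).
Proof.
move=> Fc; elim: s => [|i s IHs].
  under [in LHS]eq_fun do rewrite big_nil.
  by rewrite functional_cst big_nil.
under [in LHS]eq_fun do rewrite big_cons.
by rewrite functionalD ?IHs ?big_cons//; exact: continuous_sum.
Qed.

End positive_functional_theory.

Section outer_measure.
Variables (R : realType) (X : topologicalType) (Lam : (X -> R) -> R).
Hypothesis Lam_pos : positive_functional Lam.

(** [c] bounds the functional on a nondecreasing sequence of nonnegative
    continuous functions that is eventually at least 1 at each point of [A]. *)
Definition cover_bound (A : set X) (c : R) : Prop :=
  exists f : nat -> X -> R,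
    [/\ forall n, continuous (f n), forall n x, 0 <= f n x,
        forall x, {homo f ^~ x : m n / (m <= n)%N >-> m <= n},
        forall n, Lam (f n) <= c & forall x, A x -> exists n, 1 <= f n x].

(** For a positive functional the bound 1 is always available, so that this infimum of a set of
    nonnegative reals is never that of the empty set. *)
Definition functional_outer (A : set X) : R := inf (cover_bound A).

Lemma cover_bound_ge0 A c : cover_bound A c -> 0 <= c.
Proof.
by move=> [f [fc f0 _ fle _]]; apply: le_trans (fle 0%N); exact: functional_ge0.
Qed.

Lemma cover_bound1 A : cover_bound A 1.
Proof.
exists (fun _ _ => 1); split => //.
- by move=> _; exact: cst_continuous.
- by move=> x m n _.
- by move=> _; rewrite (functional1 Lam_pos).
- by move=> x _; exists 0%N.
Qed.

Lemma functional_outer_le A c : cover_bound A c -> functional_outer A <= c.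
Proof. by move=> Ac; apply: ge_inf => //; exists 0 => b /cover_bound_ge0. Qed.

Lemma functional_outer_le_fun A (f : X -> R) :
  continuous f -> (forall x, 0 <= f x) ->
  (forall x, A x -> 1 <= f x) -> functional_outer A <= Lam f.
Proof.
move=> fc f0 f1; apply: functional_outer_le; exists (fun=> f); split => //.
- by move=> x m n _.
- by move=> x Ax; exists 0%N; exact: f1.
Qed.

Lemma le_functional_outer_inf A b :
  (forall c, cover_bound A c -> b <= c) -> b <= functional_outer A.
Proof. by move=> H; apply: lb_le_inf => //; exists 1; exact: cover_bound1. Qed.

Lemma functional_outer_adherent A e : 0 < e ->
  exists2 c, cover_bound A c & c < functional_outer A + e.
Proof.
move=> e0; apply: inf_adherent => //; split.
  by exists 1; exact: cover_bound1.
by exists 0 => b /cover_bound_ge0.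
Qed.

Lemma functional_outer_ge0 A : 0 <= functional_outer A.
Proof. by apply: le_functional_outer_inf => c /cover_bound_ge0. Qed.

Lemma functional_outer0 : functional_outer set0 = 0.
Proof.
apply/eqP; rewrite eq_le functional_outer_ge0 andbT.
apply: functional_outer_le; exists (fun _ _ => 0); split => //.
- by move=> _; exact: cst_continuous.
- by move=> x m n _.
- by move=> _; rewrite (functional_cst Lam_pos).
Qed.

Lemma le_functional_outer A B : A `<=` B ->
  functional_outer A <= functional_outer B.
Proof.
move=> AB; apply: le_functional_outer_inf => c [f [fc f0 fhomo fle f1]].
by apply: functional_outer_le; exists f; split => // x /AB /f1.
Qed.

(** The same outer measure, with extended real values. *)
Definition functional_mu (A : set X) : \bar R := (functional_outer A)%:E.

(** A cover of [\bigcup_i F i] is the sequence [\sum_(i < n) f i n], where [f i]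
    covers [F i] with an excess of at most [e / 2 ^ i.+1]. *)
Lemma functional_mu_sigma_subadditive : sigma_subadditive functional_mu.
Proof.
move=> F; have mu0 n : (0 <= functional_mu (F n))%E.
  by rewrite lee_fin functional_outer_ge0.
have [->|Sfin] := eqVneq (\sum_(i <oo) functional_mu (F i))%E +oo%E.
  exact: leey.
apply/lee_addgt0Pr => e e0.
pose a i := functional_outer (F i) + e / (2 ^ i.+1)%:R.
have eps_gt0 i : 0 < e / (2 ^ i.+1)%:R by rewrite divr_gt0// ltr0n expn_gt0.
pose P i (g : nat -> X -> R) := [/\ forall n, continuous (g n),
  forall n x, 0 <= g n x, forall x, {homo g ^~ x : m n / (m <= n)%N >-> m <= n},
  forall n, Lam (g n) <= a i & forall x, F i x -> exists n, 1 <= g n x].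
have [f Pf] : {f : nat -> nat -> X -> R & forall i, P i (f i)}.
  apply: (@choice _ _ P).
  move=> i; have [c [g [gc g0 gh gle g1]] cle] :=
    functional_outer_adherent (F i) (eps_gt0 i).
  by exists g; split => // n; exact: le_trans (gle n) (ltW cle).
apply: le_trans (epsilon_trick xpredT mu0 (ltW e0)).
have a0 i : (0 <= (a i)%:E)%E.
  by rewrite lee_fin addr_ge0 ?functional_outer_ge0// ltW.
have Slim n : ((\sum_(i < n) a i)%:E <= \sum_(i <oo) (a i)%:E)%E.
  rewrite -sumEFin -(big_mkord xpredT (fun i => (a i)%:E)).
  by apply: nneseries_lim_ge => i _ _.
have -> : (\sum_(i <oo) (functional_mu (F i) + (e / (2 ^ i.+1)%:R)%:E) =
           \sum_(i <oo) (a i)%:E)%E by [].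
move: Slim; case: (\sum_(i <oo) (a i)%:E)%E => [S| |] Slim; last 2 first.
- exact: leey.
- by have := Slim 0%N; rewrite big_ord0.
rewrite lee_fin; apply: functional_outer_le.
exists (fun n x => \sum_(i < n) f i n x); split.
- by move=> n; apply: continuous_sum => i; have [] := Pf i.
- by move=> n x; apply: sumr_ge0 => i _; have [_ + _ _ _] := Pf i; exact.
- move=> x m n mn; rewrite -(big_mkord xpredT (fun i => f i n x)).
  rewrite (big_cat_nat (leq0n m) mn)//= big_mkord -[leLHS]addr0 lerD//.
    by apply: ler_sum => i _; have [_ _ + _ _] := Pf i; exact.
  by apply: sumr_ge0 => i _; have [_ + _ _ _] := Pf i; exact.
- move=> n; rewrite functional_sum//; last by move=> i; have [] := Pf i.
  rewrite -lee_fin; apply: le_trans (Slim n); rewrite lee_fin.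
  by apply: ler_sum => i _; have [_ _ _ + _] := Pf i; exact.
- move=> x [i _ Fix]; have [_ _ fh _ /(_ x Fix)[n fn1]] := Pf i.
  have li : (i < maxn i.+1 n)%N by rewrite leq_max leqnn.
  exists (maxn i.+1 n); rewrite (bigD1 (Ordinal li))//=.
  apply: le_trans fn1 (le_trans (fh x _ _ (leq_maxr i.+1 n)) _).
  by rewrite lerDl; apply: sumr_ge0 => j _; have [_ + _ _ _] := Pf j; exact.
Qed.

End outer_measure.

(** * Continuous functions against Borel probabilities *)

Section borel_sets.
Variables (R : realType) (X : ptopologicalType).

Lemma borel_open (A : set X) : open A -> @measurable _ (borel X) A.
Proof. exact: sub_sigma_algebra. Qed.

Lemma borel_closed (A : set X) : closed A -> @measurable _ (borel X) A.
Proof.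
move=> Acl; rewrite -(setCK A); apply: measurableC.
by apply: borel_open; exact: closed_openC.
Qed.

Lemma borel_measurable_fun (f : X -> R) :
  continuous f -> measurable_fun [set: borel X] (f : borel X -> R).
Proof.
move=> /continuousP fc.
apply: (measurability _ (measurable_realfun.RGenOInfty.measurableE R)).
move=> _ [_ [a ->] <-]; rewrite setTI.
by apply: borel_open; apply: fc; exact: rray_open.
Qed.

Lemma continuous_fun_bounded (f : X -> R) : compact [set: X] -> continuous f ->
  exists2 M : R, 0 < M & forall x, `|f x| <= M.
Proof.
move=> Xc fc; have /compact_bounded[M [_ fM]] : compact (f @` setT).
  by apply: continuous_compact => //; exact: continuous_subspaceT.
exists (Num.max M 0 + 1) => [|x].
  by rewrite (lt_le_trans ltr01)// lerDr le_max lexx orbT.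
by apply: fM; [rewrite ltr_pwDr// le_max lexx|exists x].
Qed.

End borel_sets.

Section borel_probability.
Variables (R : realType) (X : ptopologicalType).
Hypothesis X_compact : compact [set: X].
Variable mu : probability (borel X) R.

Lemma continuous_integrable (f : X -> R) :
  continuous f -> mu.-integrable setT (EFin \o f).
Proof.
move=> fc; have [M M0 fM] := continuous_fun_bounded X_compact fc.
apply: measurable_bounded_integrable => //.
- by rewrite (le_lt_trans (probability_le1 mu measurableT))// ltry.
- exact: borel_measurable_fun.
- exists M; split; first exact: num_real.
  by move=> N MN x _; exact: le_trans (fM x) (ltW MN).
Qed.

Lemma Rintegral_positive_functional :
  positive_functional (fun f : X -> R => \int[mu]_x f x).
Proof.
split => [f g fc gc|c f fc|f fc f0|].
- by rewrite RintegralD//; exact: continuous_integrable.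
- by rewrite RintegralZl//; exact: continuous_integrable.
- by apply: Rintegral_ge0 => x _; exact: f0.
- by rewrite Rintegral_cst// mul1r; exact: (congr1 fine (probability_setT mu)).
Qed.

Let integral_indic_scale (c : R) (A : set X) : @measurable _ (borel X) A ->
  mu.-integrable setT (EFin \o (fun x => c * \1_A x)) /\
  \int[mu]_x (c * \1_A x) = c * fine (mu A).
Proof.
move=> mA; have iA : mu.-integrable setT (EFin \o (\1_A : borel X -> R)).
  exact: integrable_indic.
split; last first.
  by rewrite RintegralZl// /Rintegral integral_indic// setIT.
have := integrableZl measurableT c iA.
by apply: eq_integrable => // x _; rewrite /= EFinM.
Qed.

Lemma Rintegral_le_measure (c : R) (f : X -> R) (A : set X) : continuous f ->
  @measurable _ (borel X) A -> (forall x, f x <= c) ->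
  (forall x, ~ A x -> f x <= 0) -> \int[mu]_x f x <= c * fine (mu A).
Proof.
move=> fc mA fle fA; have [icA <-] := integral_indic_scale c mA.
apply: le_Rintegral => // [|x _]; first exact: continuous_integrable.
rewrite indicE; have [Ax|/negP nAx] := boolP (x \in A); first by rewrite mulr1.
by rewrite mulr0 fA// => /mem_set.
Qed.

Lemma measure_le_Rintegral (c : R) (f : X -> R) (A : set X) : continuous f ->
  @measurable _ (borel X) A -> (forall x, 0 <= f x) ->
  (forall x, A x -> c <= f x) -> c * fine (mu A) <= \int[mu]_x f x.
Proof.
move=> fc mA f0 fA; have [icA <-] := integral_indic_scale c mA.
apply: le_Rintegral => // [|x _]; first exact: continuous_integrable.
rewrite indicE; have [Ax|_] := boolP (x \in A); last by rewrite mulr0.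
by rewrite mulr1 fA//; exact: set_mem.
Qed.

End borel_probability.

(** * The Riesz representation theorem on a compact metrizable space *)

Section riesz_representation.
Variables (R : realType) (X : ptopologicalType).
Hypotheses (X_compact : compact [set: X]) (X_metrizable : metrizable R X).
Variable Lam : (X -> R) -> R.
Hypothesis Lam_pos : positive_functional Lam.

Local Notation outer := (functional_outer Lam).
Local Notation mu := (functional_mu Lam).

HB.instance Definition _ := isOuterMeasure.Build R X mu
  (congr1 EFin (functional_outer0 Lam_pos))
  (fun A => functional_outer_ge0 Lam_pos A)
  (fun A B AB => le_functional_outer Lam_pos AB)
  (functional_mu_sigma_subadditive Lam_pos).

(** With [h k] nondecreasing to the indicator function of [F], a cover [f n] of
    [E] splits into the covers [f n * h n] of [E `&` F] and [f n * (1 - h k)],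
    for one large [k], of [E `\` F]. *)
Lemma caratheodory_open (F : set X) : open F -> mu.-caratheodory F.
Proof.
move=> Fop; have [phi [phic phi0 phiF]] :=
  closed_zero_set X_metrizable (open_closedC Fop).
apply: le_caratheodory_measurable => E.
rewrite /functional_mu -EFinD lee_fin.
apply: le_functional_outer_inf => // c [f [fc f0 fh fle f1]].
pose h k x := Num.min 1 (k%:R * phi x).
have hc k : continuous (h k).
  move=> x; apply: (@continuous_min R X (fun=> 1) (fun x => k%:R * phi x)).
    exact: cst_continuous.
  exact: continuous_scale.
have h0 k x : 0 <= h k x by rewrite le_min ler01 mulr_ge0.
have h1 k x : h k x <= 1 by rewrite ge_min lexx.
have hh x m n : (m <= n)%N -> h m x <= h n x.
  move=> mn; rewrite /h le_min !ge_min lexx/=.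
  by apply/orP; right; rewrite ler_wpM2r// ler_nat.
pose g n x := f n x * h n x.
have gc n : continuous (g n) by move=> x; apply: cvgM; [exact: fc|exact: hc].
pose S := [set Lam (g n) | n in [set: nat]].
have Sub : ubound S c.
  move=> _ [n _ <-]; apply: le_trans (fle n); apply: le_functional => // x.
  by rewrite /g ler_piMr.
have supS : has_sup S by split; [exists (Lam (g 0%N)), 0%N|exists c].
have EF : outer (E `&` F) <= sup S.
  apply: functional_outer_le => //; exists g; split => //.
  - by move=> n x; rewrite mulr_ge0.
  - by move=> x m n mn; rewrite ler_pM// ?fh// hh.
  - by move=> n; apply: ub_le_sup; [exists c|exists n].
  - move=> x [/f1[n fn1] Fx]; have phi_gt0 : 0 < phi x.
      rewrite lt_neqAle phi0 andbT eq_sym; apply/eqP => /phiF; exact.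
    have [k hk] : exists k, h k x = 1.
      exists (Num.truncn (phi x)^-1).+1; apply/min_idPl.
      by rewrite -ler_pdivrMr// mul1r ltW// truncnS_gt.
    exists (maxn n k); rewrite -[leLHS]mulr1 ler_pM//.
      exact: le_trans fn1 (fh x _ _ (leq_maxl n k)).
    by rewrite -hk hh// leq_maxr.
apply/ler_addgt0Pr => e e0.
have [_ [k _ <-] Sk] := sup_adherent e0 supS.
have fhc n : continuous (fun x => f n x * h k x).
  by move=> x; apply: cvgM; [exact: fc|exact: hc].
pose f' n x := f n x - f n x * h k x.
have f'c n : continuous (f' n) by move=> x; apply: cvgB; [exact: fc|exact: fhc].
have f'h x m n : (m <= n)%N -> f' m x <= f' n x.
  have f'E i : f' i x = f i x * (1 - h k x) by rewrite mulrBr mulr1.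
  by move=> mn; rewrite !f'E ler_wpM2r ?fh// subr_ge0.
have EnF : outer (E `&` ~` F) <= c - (sup S - e).
  apply: functional_outer_le => //; exists f'; split => //.
  - by move=> n x; rewrite subr_ge0 ler_piMr.
  - move=> n; have kn := leq_maxr n k.
    apply: (@le_trans _ _ (Lam (f' (maxn n k)))).
      by apply: le_functional => // x; apply: f'h; exact: leq_maxl.
    rewrite functionalB// lerB// (le_trans (ltW Sk))//.
    by apply: le_functional => // x; rewrite /g ler_wpM2r// fh.
  - move=> x [/f1[n fn1] nFx]; exists n.
    by rewrite /f' /h ((phiF x).1 nFx) mulr0 min_r// mulr0 subr0.
by have := lerD EF EnF; lra.
Qed.

Lemma borel_caratheodory (A : set X) :
  @measurable _ (borel X) A -> mu.-cara.-measurable A.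
Proof.
apply: smallest_sub; last exact: caratheodory_open.
exact: sigma_algebra_measurable.
Qed.

Lemma functional_outerT : outer setT = 1.
Proof.
apply/eqP; rewrite eq_le functional_outer_le//=; last exact: cover_bound1.
apply: le_functional_outer_inf => // c [f [fc f0 fh fle f1]].
apply/ler_addgt0Pr => e e0.
(* The increasing open sets [f n > 1 - e] cover the space. *)
have [n fn] : exists n, forall x, 1 - e <= f n x.
  have := X_compact; rewrite compact_cover => /(_ nat setT
    (fun n => [set x | 1 - e < f n x]))[].
  - move=> n _; have /continuousP fnc := fc n.
    by have := fnc _ (rray_open (1 - e)); rewrite preimage_itvoy.
  - move=> x _; have [n fn1] := f1 x I; exists n => //=.
    by rewrite (lt_le_trans _ fn1)// ltrBlDr ltrDl.
  move=> D _ cov; exists (\max_(i <- finmap.enum_fset D) i) => x.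
  have [i /= iD fi] := cov x I.
  by rewrite (le_trans (ltW fi))// fh// leq_bigmax_seq.
rewrite -lerBlDr (le_trans _ (fle n))//.
rewrite -[leLHS](functional_cst Lam_pos).
by apply: le_functional => //; exact: cst_continuous.
Qed.

Let mu_borel : set (borel X) -> \bar R := mu.

Let mu_borel_sigma_additive : semi_sigma_additive mu_borel.
Proof.
move=> F mF tF mUF; apply: (@caratheodory_measure_sigma_additive R X mu) => //.
- by move=> i; exact: borel_caratheodory.
- exact: borel_caratheodory.
Qed.

HB.instance Definition _ := isMeasure.Build _ (borel X) R mu_borel
  (outer_measure0 mu) (outer_measure_ge0 mu) mu_borel_sigma_additive.

HB.instance Definition _ := Measure_isProbability.Build _ (borel X) R mu_borel
  (congr1 EFin functional_outerT).

Local Notation P := (mu_borel : probability (borel X) R).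

(** The slices [min (max (f - k * d) 0) d] of height [d] add up to [f].  The
    slice of index [k.+1] is supported on [f >= k.+1 * d], whose measure is at
    most [Lam] of the slice of index [k], divided by [d]. *)
Lemma Rintegral_le_functional (f : X -> R) : continuous f ->
  (forall x, 0 <= f x) -> \int[P]_x f x <= Lam f.
Proof.
move=> fc f0; have [M M0 fM] := continuous_fun_bounded X_compact fc.
have Ppos := Rintegral_positive_functional X_compact P.
apply/ler_addgt0Pr => d d0.
pose n := (Num.truncn (M / d)).+1.
have fn x : f x <= n%:R * d.
  rewrite (le_trans (ler_norm _))// (le_trans (fM x))// -ler_pdivrMr//.
  by rewrite ltW// truncnS_gt.
pose s k x := Num.min (Num.max (f x - k%:R * d) 0) d.
have sc k : continuous (s k).
  move=> x; apply: (@continuous_min R X (fun x => Num.max (f x - k%:R * d) 0)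
    (fun=> d)); last exact: cst_continuous.
  apply: (@continuous_max R X (fun x => f x - k%:R * d) (fun=> 0)).
    by apply: cvgB; [exact: fc|exact: cst_continuous].
  exact: cst_continuous.
have s0 k x : 0 <= s k x by rewrite le_min le_max lexx orbT ltW.
have sd k x : s k x <= d by rewrite ge_min lexx orbT.
have s_sum m x : \sum_(k < m) s k x = Num.min (f x) (m%:R * d).
  elim: m => [|m IHm]; first by rewrite big_ord0 mul0r min_r.
  rewrite big_ord_recr/= IHm /s -natr1 mulrDl mul1r /Num.max.
  case: ifPn; rewrite -?leNgt /Num.min => ?;
    by repeat (case: ifPn; rewrite -?leNgt => ?); lra.

have f_sum m : (n <= m)%N -> f = (fun x => \sum_(k < m) s k x).
  move=> nm; apply/funext => x; rewrite s_sum min_l// (le_trans (fn x))//.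
  by rewrite ler_wpM2r ?ler_nat// ltW.
have level k : \int[P]_x s k.+1 x <= Lam (s k).
  pose A := [set x | k.+1%:R * d <= f x].
  have Acl : closed A.
    by move/continuous_closedP : fc => /(_ _ (@closed_ge _ (k.+1%:R * d))).
  apply: (@le_trans _ _ (d * outer A)).
    apply: (Rintegral_le_measure X_compact P (sc k.+1)) => [|x|x /negP].
    - exact: borel_closed.
    - exact: sd.
    - rewrite -ltNge => fx; rewrite /s max_r; last by rewrite subr_le0 ltW.
      by rewrite min_l// ltW.
  rewrite -ler_pdivlMl// -(functionalZ Lam_pos)//.
  apply: functional_outer_le_fun => // [|x|x Ax].
  - exact: continuous_scale.
  - by rewrite mulr_ge0// invr_ge0 ltW.
  - rewrite ler_pdivlMl// mulr1 /s le_min lexx andbT le_max lerBrDl.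
    by move: Ax; rewrite /A/= -natr1 mulrDl mul1r => ->.
rewrite {1}(f_sum n.+1)// (functional_sum Ppos)// big_ord_recl addrC lerD//.
  rewrite [in leRHS](f_sum n)// (functional_sum Lam_pos)//.
  by apply: ler_sum => k _; exact: level.
rewrite -[leRHS](functional_cst Ppos).
by apply: (le_functional Ppos) => //; exact: cst_continuous.
Qed.

Theorem riesz_representation : exists mu : probability (borel X) R,
  forall f : X -> R, continuous f -> \int[mu]_x f x = Lam f.
Proof.
exists P => f fc; have Ppos := Rintegral_positive_functional X_compact P.
have le_all g : continuous g -> \int[P]_x g x <= Lam g.
  move=> gc; have [M M0 gM] := continuous_fun_bounded X_compact gc.
  have cM : continuous (fun _ : X => M) by exact: cst_continuous.
  have gMc : continuous (fun x => g x + M).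
    by move=> x; apply: cvgD; [exact: gc|exact: cM].
  have := Rintegral_le_functional gMc.
  rewrite (functionalD Ppos)// (functional_cst Ppos) (functionalD Lam_pos)//.
  rewrite (functional_cst Lam_pos) lerD2r; apply => x.
  by have := gM x; rewrite ler_norml => /andP[]; lra.
apply/eqP; rewrite eq_le le_all//= -lerN2.
have fNc := continuous_scale (c := -1) fc.
by have := le_all _ fNc; rewrite (functionalZ Ppos)// (functionalZ Lam_pos)// !mulN1r.
Qed.

End riesz_representation.
(** * Weak* compactness and small neighborhoods of null sets *)

Lemma cvg_initial (S : choiceType) (T : topologicalType) (g : S -> T)
    (F : set_system S) (s : S) : Filter F ->
  g @ F --> g s -> F --> (s : initial_topology g).
Proof.
move=> FF gF A [_ [[B Bop <-] Bs sBA]]; apply: filterS sBA _.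
exact: (gF B (open_nbhs_nbhs (conj Bop Bs))).
Qed.

Lemma ultra_fmap_cvg (S : Type) (T : topologicalType) (g : S -> T)
    (F : set_system S) (K : set T) :
  UltraFilter F -> compact K -> (forall s, K (g s)) ->
  exists l : T, g @ F --> l.
Proof.
move=> FU Kc gK; have FP := @ultra_proper _ _ FU.
have FgK : (g @ F) K by apply: (@filterE _ F) => s; exact: gK.
have [l [_ lcl]] := Kc (g @ F) _ FgK.
exists l => B Bl; have [//|nFB] := in_ultra_setVsetC (g @^-1` B) FU.
by have [y [nBy By]] := lcl (~` B) B nFB Bl.
Qed.

Section weak_star_compactness.
Variables (R : realType) (X : ptopologicalType).
Hypotheses (X_compact : compact [set: X]) (X_metrizable : metrizable R X).

(** Along an ultrafilter the integrals of each continuous function converge;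
    the limits form a positive functional, hence come from a probability. *)
Theorem weak_star_compact : compact [set: weak_star R X].
Proof.
rewrite compact_ultra => F FU _.
have FP : ProperFilter F by exact: ultra_proper.
pose I f (nu : probability (borel X) R) := \int[nu]_x (f : X -> R) x.
have Ipos (nu : probability (borel X) R) : positive_functional (I ^~ nu).
  exact: Rintegral_positive_functional.
have [Lam LamP] : {Lam : (X -> R) -> R &
    forall f : X -> R, continuous f -> I f @ F --> Lam f}.
  apply: (@choice _ _ (fun (f : X -> R) (l : R) => continuous f -> I f @ F --> l)) => f.
  have [fc|nfc] := pselect (continuous f); last by exists 0.
  have [M M0 fM] := continuous_fun_bounded X_compact fc.
  have [|l Il] := ultra_fmap_cvg (g := I f) FU (@segment_compact R (- M) M).
    move=> nu; rewrite /= in_itv/=.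
    have cM c : continuous (fun _ : X => c : R) by exact: cst_continuous.
    apply/andP; split.
      rewrite -[leLHS](functional_cst (Ipos nu)).
      apply: (le_functional (Ipos nu)) => // x.
      by have := fM x; rewrite ler_norml => /andP[].
    rewrite -[leRHS](functional_cst (Ipos nu)).
    apply: (le_functional (Ipos nu)) => // x.
    by have := fM x; rewrite ler_norml => /andP[].
  by exists l.
have Lam_pos : positive_functional Lam.
  split.
  - move=> f g fc gc; have fgc : continuous (fun x => f x + g x).
      by move=> x; apply: cvgD; [exact: fc|exact: gc].
    apply: (cvg_unique (@norm_hausdorff _ R^o) (LamP _ fgc)).
    have -> : I (fun x => f x + g x) = (fun nu => I f nu + I g nu).
      by apply/funext => nu; exact: (functionalD (Ipos nu)).
    by apply: cvgD; exact: LamP.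
  - move=> c f fc; have cfc := continuous_scale (c := c) fc.
    apply: (cvg_unique (@norm_hausdorff _ R^o) (LamP _ cfc)).
    have -> : I (fun x => c * f x) = (fun nu => c * I f nu).
      by apply/funext => nu; exact: (functionalZ (Ipos nu)).
    by apply: cvgM; [exact: cvg_cst|exact: LamP].
  - move=> f fc f0.
    apply: (@closed_cvg _ R F FP (I f) (fun y => 0 <= y) (@closed_ge _ 0)) (LamP f fc).
    by apply: nearW => nu; exact: (functional_ge0 (Ipos nu)).
  - have c1 : continuous (fun _ : X => 1 : R) by exact: cst_continuous.
    apply: (cvg_unique (@norm_hausdorff _ R^o) (LamP _ c1)).
    have -> : I (fun=> 1) = (fun=> 1).
      by apply/funext => nu; exact: (functional1 (Ipos nu)).
    exact: cvg_cst.
have [mu muLam] := riesz_representation X_compact X_metrizable Lam_pos.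
exists mu; split => //; apply: cvg_initial; apply/cvg_sup => -[f fc].
apply: cvg_initial => /=.
by have := LamP f fc; rewrite -(muLam f fc).
Qed.

Variable N : set (probability (borel X) R).
Hypothesis N_closed : closed (N : set (weak_star R X)).

(** A lower bound on the integrals of a continuous function passes from a tail
    of a sequence in [N] to some cluster point of the sequence in [N]. *)
Lemma weak_star_cluster (nu : nat -> probability (borel X) R) :
  (forall n, N (nu n)) ->
  exists2 mu, N mu & forall f : X -> R, continuous f -> forall c n,
    (forall m, (n <= m)%N -> c <= \int[nu m]_x f x) -> c <= \int[mu]_x f x.
Proof.
move=> Nnu; have Nc : compact (N : set (weak_star R X)).
  exact: subclosed_compact N_closed weak_star_compact _.
have nuN : ((nu : nat -> weak_star R X) @ \oo) N by exists 0%N => // n _; exact: Nnu.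
have [mu [Nmu mucl]] := Nc _ _ nuN.
exists mu => // f fc c n nuc; rewrite leNgt; apply/negP => muc.
pose g (mu' : weak_star R X) : R := \int[mu']_x f x.
have gc : continuous g.
  have ic := @initial_continuous (probability (borel X) R) _ (@weak_star_eval R X).
  move=> mu'; have /cvg_sup /(_ (exist _ f fc)) pc := ic mu'.
  pose ev (h : {h : X -> R | continuous h} -> R) := h (exist _ f fc).
  have evc := @initial_continuous _ R ev.
  by move=> B /(evc (weak_star_eval mu'))/pc; apply; apply: fmap_filter; exact: nbhs_filter.
have [] := mucl [set mu' | c <= g mu'] [set mu' | g mu' < c].
- by exists n.
- exact: (gc mu [set y | y < c] (open_nbhs_nbhs (conj (@open_lt R c) muc))).
- by move=> mu' [/= cg]; rewrite ltNge cg.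
Qed.

(** Otherwise, with [F = [set x | phi x = 0]], some [nu n] in [N] gives the
    neighborhood [phi < n.+1%:R^-1] of [F] a measure larger than [e].  A cluster
    point of that sequence gives every neighborhood [phi < 2 / n.+1%:R] measure
    at least [e / 2], hence also [F]. *)
Lemma small_neighborhood (F : set X) (e : R) : closed F ->
  (forall mu, N mu -> mu F = 0%E) -> 0 < e ->
  exists U : set X, [/\ open U, F `<=` U & forall mu, N mu -> (mu U <= e%:E)%E].
Proof.
move=> Fcl F0 e0; have [phi [phic phi0 phiF]] := closed_zero_set X_metrizable Fcl.
apply: contrapT => noU.
pose U n := [set x | phi x < n.+1%:R^-1].
have Uop n : open (U n).
  move/continuousP : phic => /(_ _ (@open_lt _ (n.+1%:R^-1))).
  exact.
have FU n : F `<=` U n by move=> x /phiF; rewrite /U/= => ->; rewrite invr_gt0.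
have [nu nuP] : {nu : nat -> probability (borel X) R &
    forall n, N (nu n) /\ (e%:E < nu n (U n))%E}.
  apply: (@choice _ _ (fun n (m : probability (borel X) R) =>
    N m /\ (e%:E < m (U n))%E)) => n.
  apply: contrapT => none; apply: noU; exists (U n); split => // mu Nmu.
  by rewrite leNgt; apply/negP => muU; apply: none; exists mu.
have [mu Nmu mule] := weak_star_cluster (fun n => (nuP n).1).
(* [psi n] is at least 1 on [U m] for [n <= m] and vanishes off [V n]. *)
pose psi n x := Num.max 0 (2 - n.+1%:R * phi x).
pose V n := [set x | phi x < 2 / n.+1%:R].
have psic n : continuous (psi n).
  move=> x; apply: (@continuous_max R X (fun=> 0) (fun x => 2 - n.+1%:R * phi x)).
    exact: cst_continuous.
  by apply: cvgB; [exact: cst_continuous|exact: continuous_scale].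
have Vop n : open (V n).
  move/continuousP : phic => /(_ _ (@open_lt _ (2 / n.+1%:R))).
  exact.
have muV n : e / 2 <= fine (mu (V n)).
  rewrite ler_pdivrMr// mulrC.
  apply: (@le_trans _ _ (\int[mu]_x psi n x)); last first.
    apply: (Rintegral_le_measure X_compact mu (psic n)) => [|x|x].
    - exact: borel_open.
    - by rewrite ge_max ler0n/= gerBl mulr_ge0.
    - move=> /negP; rewrite -leNgt ler_pdivrMr// mulrC => phix.
      by rewrite /psi max_l// subr_le0.
  apply: (mule _ (psic n) e n) => m nm.
  apply: (@le_trans _ _ (1 * fine (nu m (U m)))).
    have [_] := nuP m; rewrite mul1r => /ltW.
    by rewrite -lee_fin fineK// fin_num_measure//; exact: borel_open.
  apply: (measure_le_Rintegral X_compact (nu m) (psic n)) => [|x|x Ux].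
  - exact: borel_open.
  - by rewrite le_max lexx.
  - rewrite le_max; apply/orP; right; rewrite lerBrDr -lerBrDl.
    have : n.+1%:R * phi x <= n.+1%:R * m.+1%:R^-1.
      by rewrite ler_wpM2l//; exact: ltW.
    move=> /le_trans -> //; rewrite ler_pdivrMr// (_ : 2 - 1 = 1); last by ring.
    by rewrite mul1r ler_nat.
have VF : \bigcap_n V n = F.
  apply/seteqP; split=> [x Vx|x Fx n _]; last first.
    by rewrite /V/= ((phiF x).1 Fx) divr_gt0.
  apply/phiF/eqP; rewrite eq_le phi0 andbT; apply/ler_addgt0Pr => d d0.
  rewrite add0r; have := Vx (Num.truncn (2 / d)) I; rewrite /V/= => /ltW/le_trans.
  apply; rewrite ler_pdivrMr// mulrC -ler_pdivrMr//.
  by rewrite ltW// truncnS_gt.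
have Vdec : nonincreasing_seq V.
  move=> m n mn; apply/subsetPset => x; rewrite /V/= => /lt_le_trans; apply.
  by rewrite ler_pM2l// lef_pV2 ?posrE// ler_nat.
have Vcvg : mu \o V @ \oo --> mu (\bigcap_n V n).
  apply: nonincreasing_cvg_mu => //.
  - by rewrite ltey_eq fin_num_measure//; exact: borel_open.
  - by move=> n; exact: borel_open.
  - by rewrite VF; exact: borel_closed.
rewrite VF F0// in Vcvg.
suff : ((e / 2)%:E <= 0)%E by rewrite lee_fin leNgt divr_gt0.
have -> : 0%E = limn (mu \o V) by apply/esym/cvg_lim.
apply: lime_ge; first by apply/cvg_ex; exists 0%E.
apply: nearW => n /=.
by rewrite -(@fineK _ (mu (V n))) ?lee_fin// fin_num_measure//; exact: borel_open.
Qed.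

End weak_star_compactness.

(** * Separating the level sets of a function up to a small set *)

Section distinct_values.
Variable R : realType.

Lemma itv_avoid_seq (s : seq R) (a b : R) : a < b ->
  exists2 c, a < c < b & c \notin s.
Proof.
elim: s a b => [|z s IHs] a b ab; first by exists ((a + b) / 2); rewrite ?midf_lt.
have [am mb] : a < (a + b) / 2 /\ (a + b) / 2 < b by rewrite !midf_lt.
have [zm|mz] := ltP z ((a + b) / 2).
  have [c /andP[mc cb] cs] := IHs _ _ mb; exists c.
    by rewrite cb (lt_trans am).
  by rewrite inE negb_or cs gt_eqF// (lt_trans zm).
have [c /andP[ac cm] cs] := IHs _ _ am; exists c.
  by rewrite ac (lt_trans cm).
by rewrite inE negb_or cs lt_eqF// (lt_le_trans cm).
Qed.

Lemma distinct_near_values (n : nat) (y : nat -> R) (e : R) : 0 < e ->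
  exists c : nat -> R, (forall i, (i < n)%N -> y i < c i < y i + e) /\
    (forall i j, (i < n)%N -> (j < n)%N -> c i = c j -> i = j).
Proof.
move=> e0; elim: n => [|n [c [cy cinj]]]; first by exists y; split.
have yne : y n < y n + e by rewrite ltrDl.
have [z zy zc] := itv_avoid_seq [seq c i | i <- iota 0 n] yne.
have zNc i : (i < n)%N -> c i != z.
  move=> ni; apply: contra zc => /eqP <-.
  by apply: map_f; rewrite mem_iota.
exists (fun i => if (i < n)%N then c i else z); split.
  move=> i; rewrite ltnS leq_eqVlt => /predU1P[->|ni]; first by rewrite ltnn.
  by rewrite ni cy.
move=> i j; rewrite ltnS leq_eqVlt => /predU1P[->|ni];
  rewrite ltnS leq_eqVlt => /predU1P[->|nj] //; rewrite ?ltnn ?ni ?nj.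
- by move=> /esym/eqP; rewrite (negbTE (zNc _ nj)).
- by move=> /eqP; rewrite (negbTE (zNc _ ni)).
- exact: cinj.
Qed.

Lemma distinct_values_gap (n : nat) (c : nat -> R) :
  (forall i j, (i < n)%N -> (j < n)%N -> c i = c j -> i = j) ->
  exists2 d : R, 0 < d &
    forall i j, (i < n)%N -> (j < n)%N -> `|c i - c j| <= 2 * d -> i = j.
Proof.
move=> cinj.
pose m : R := \big[Num.min/1]_(p : 'I_n * 'I_n | p.1 != p.2) `|c p.1 - c p.2|.
have m0 : 0 < m.
  apply: lt_bigmin => // -[i j] /= ij; rewrite normr_gt0 subr_eq0.
  by apply: contra ij => /eqP/cinj ij; apply/eqP/val_inj/ij.
exists (m / 3); first by rewrite divr_gt0.
move=> i j ni nj cij; apply/eqP; apply: contraTT cij => ij; rewrite -ltNge.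
have mle : m <= `|c i - c j|.
  by apply: (@bigmin_le_cond _ _ _ _ (Ordinal ni, Ordinal nj)).
by apply: lt_le_trans mle; lra.
Qed.

End distinct_values.

(** [f] takes values in [0, 1], is 0 on [A0] and 1 on [A1]. *)
Definition urysohn_function (R : realType) (X : topologicalType)
    (A0 A1 : set X) (f : X -> R) : Prop :=
  [/\ continuous f, forall x, 0 <= f x <= 1,
      forall x, A0 x -> f x = 0 & forall x, A1 x -> f x = 1].

Section level_sets.
Variables (R : realType) (X : ptopologicalType).
Hypotheses (X_compact : compact [set: X]) (X_metrizable : metrizable R X).
Variables A0 A1 : set X.

(** A Urysohn function is made constant on each [L i] by a change supported in
    the disjoint sets [W i], on which it is already close to that constant. *)
Lemma flatten_on_sets (n : nat) (L W : nat -> set X) (c : nat -> R) (e : R)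
    (f : X -> R) : urysohn_function A0 A1 f -> 0 <= e ->
  (forall i, (i < n)%N -> [/\ closed (L i), open (W i), L i `<=` W i,
     W i `<=` ~` (A0 `|` A1) & 0 <= c i <= 1]) ->
  (forall i x, (i < n)%N -> W i x -> `|f x - c i| <= e) ->
  (forall i j x, (i < n)%N -> (j < n)%N -> W i x -> W j x -> i = j) ->
  exists f', [/\ urysohn_function A0 A1 f', forall x, `|f' x - f x| <= e,
    forall i x, (i < n)%N -> L i x -> f' x = c i &
    forall x, (forall i, (i < n)%N -> ~ W i x) -> f' x = f x].
Proof.
move=> fU e0; elim: n => [|n IHn] LW fc Wdis.
  by exists f; split => // x; rewrite subrr normr0.
have [|i x ni|i j x ni nj|g [[gc g01 gA0 gA1] gf gL gW]] := IHn.
- by move=> i ni; apply: LW; exact: ltnW.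
- by apply: fc; exact: ltnW.
- by apply: Wdis; exact: ltnW.
have [Ln Wn LWn WnA cn] := LW n (ltnSn n).
have [u [uc u01 uL uW]] := bump_function X_metrizable Ln Wn LWn.
have u0A x : (A0 `|` A1) x -> u x = 0.
  by move=> Ax; apply: uW => /WnA; exact.
exists (fun x => g x + u x * (c n - g x)); split.
- split.
  + move=> x; apply: cvgD; first exact: gc.
    apply: cvgM; first exact: uc.
    by apply: cvgB; [exact: cvg_cst|exact: gc].
  + move=> x; have /andP[g0 g1] := g01 x; have /andP[u0 u1] := u01 x.
    by move/andP: cn => [c0 c1]; apply/andP; split; nra.
  + by move=> x A0x; rewrite u0A ?mul0r ?addr0 ?gA0//; left.
  + by move=> x A1x; rewrite u0A ?mul0r ?addr0 ?gA1//; right.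
- move=> x; have [Wx|nWx] := pselect (W n x); last first.
    by rewrite uW// mul0r addr0.
  rewrite gW => [|i ni Wix]; last first.
    by have := Wdis i n x (ltnW ni) (ltnSn n) Wix Wx; move: ni => /[swap] ->; rewrite ltnn.
  rewrite addrAC subrr add0r normrM distrC -[leRHS]mul1r.
  have /andP[u0 u1] := u01 x.
  by apply: ler_pM => //; [rewrite ger0_norm|exact: fc].
- move=> i x; rewrite ltnS leq_eqVlt => /predU1P[->|ni] Lx.
    by rewrite uL// mul1r addrC subrK.
  rewrite uW; first by rewrite mul0r addr0 (gL i).
  move=> Wnx; have [_ _ LWi _ _] := LW i (ltnW ni).
  have := Wdis i n x (ltnW ni) (ltnSn n) (LWi _ Lx) Wnx.
  by move: ni => /[swap] ->; rewrite ltnn.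
- move=> x nW; rewrite uW; last exact: nW.
  by rewrite mul0r addr0 gW// => i ni; apply: nW; exact: ltnW.
Qed.

End level_sets.

Section small_level_sets.
Variables (R : realType) (X : ptopologicalType).
Hypotheses (X_compact : compact [set: X]) (X_metrizable : metrizable R X).
Variable N : set (probability (borel X) R).
Hypotheses (N_closed : closed (N : set (weak_star R X)))
  (N_atomless : forall mu, N mu -> atomless mu)
  (X_SBP : small_boundary_property N).
Variables A0 A1 : set X.
Hypotheses (A0_closed : closed A0) (A1_closed : closed A1).

Lemma small_basic_nbhs (x : X) (O : set X) (e : R) : open O -> O x -> 0 < e ->
  exists V : set X, [/\ open V, V x, V `<=` O, small N (boundary V) &
    forall mu, N mu -> (mu V <= e%:E)%E].
Proof.
move=> Oop Ox e0; have [B [Bop Bx] Bsmall] := X_SBP.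
have [mu Nmu|U [Uop xU Ule]] := small_neighborhood X_compact X_metrizable
  N_closed (@metrizable_closed1 _ _ X_metrizable x) _ e0; first exact: N_atomless.
have : nbhs x (O `&` U).
  by apply: open_nbhs_nbhs; split; [exact: openI|split => //; exact: xU].
move=> /(Bx x)[V [BV Vx] VOU].
exists V; split => //.
- exact: Bop.
- by move=> y /VOU[].
- exact: Bsmall.
- move=> mu Nmu; apply: le_trans (Ule mu Nmu).
  apply: le_measure; rewrite ?inE; [apply: borel_open; exact: Bop|exact: borel_open|].
  by move=> y /VOU[].
Qed.

(** [K] has a finite cover by open sets with small boundary, of measure at most
    [e], and on each of which [f] is [e]-close to a constant. *)
Lemma small_cover (K : set X) (f : X -> R) (e : R) : closed K ->
  K `<=` ~` (A0 `|` A1) -> urysohn_function A0 A1 f -> 0 < e ->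
  exists n (V : nat -> set X) (y : nat -> R),
    [/\ forall i, (i < n)%N -> [/\ open (V i), V i `<=` ~` (A0 `|` A1),
          small N (boundary (V i)) & forall mu, N mu -> (mu (V i) <= e%:E)%E],
        forall i x, (i < n)%N -> V i x -> `|f x - y i| < e,
        forall i, (i < n)%N -> 0 <= y i <= 1 &
        forall x, K x -> exists2 i, (i < n)%N & V i x].
Proof.
move=> Kcl KA [fc f01 _ _] e0.
have [V VP] : {V : X -> set X & forall x, K x -> [/\ open (V x), V x x,
    V x `<=` [set z | `|f z - f x| < e] `&` ~` (A0 `|` A1),
    small N (boundary (V x)) & forall mu, N mu -> (mu (V x) <= e%:E)%E]}.
  apply: (@choice _ _ (fun x V => K x -> [/\ open V, V x,
    V `<=` [set z | `|f z - f x| < e] `&` ~` (A0 `|` A1),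
    small N (boundary V) & forall mu, N mu -> (mu V <= e%:E)%E])) => x.
  have [Kx|nKx] := pselect (K x); last by exists set0.
  have [||V VP] := @small_basic_nbhs x
    ([set z | `|f z - f x| < e] `&` ~` (A0 `|` A1)) e _ _ e0; last by exists V.
    apply: openI; last by apply: closed_openC; exact: closedU.
    have gc : continuous (fun z => `|f z - f x|).
      by move=> z; apply: cvg_norm; apply: cvgB; [exact: fc|exact: cvg_cst].
    by move/continuousP : gc => /(_ _ (@open_lt R e)).
  by split; [rewrite /= subrr normr0|exact: KA].
have : compact K by exact: subclosed_compact Kcl X_compact _.
rewrite compact_cover => /(_ _ K V)[].
- by move=> x /VP[].
- by move=> x Kx; exists x => //; have [] := VP x Kx.
move=> D DK KD; pose s := finmap.enum_fset D.
have sK i : (i < size s)%N -> K (nth point s i).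
  by move=> si; have := DK (nth point s i) (mem_nth _ si); rewrite inE.
exists (size s), (fun i => V (nth point s i)), (fun i => f (nth point s i)).
split.
- move=> i /sK/VP[Vop _ Vsub Vsmall Vle]; split => //.
  by move=> z /Vsub[].
- by move=> i x /sK/VP[_ _ Vsub _ _] /Vsub[].
- by move=> i _; exact: f01.
- move=> x /KD[z /= zD Vzx]; exists (index z s); first by rewrite index_mem.
  by rewrite nth_index.
Qed.

Lemma boundary_open (V : set X) : open V -> boundary V = closure V `\` V.
Proof. by move=> /interior_id Vop; rewrite /boundary Vop. Qed.

(** With cover [V i], let [W i] be [V i] without the closures of the earlier
    [V j].  The [W i] are disjoint and cover [K] up to the boundaries of the
    [V i], hence up to an open set [U] of small measure.  Let [f']
    take the value [c i] on the part of [W i] in [K] and outside [U], where the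
    [c i] have pairwise gaps larger than [2 * d].  Within [K] and outside [U], a
    level set of a function [d]-close to [f'] then meets only one [W i]. *)
Lemma small_level_step (K : set X) (f : X -> R) (e eta : R) : closed K ->
  K `<=` ~` (A0 `|` A1) -> urysohn_function A0 A1 f -> 0 < e -> 0 < eta ->
  exists (f' : X -> R) (d : R),
    [/\ urysohn_function A0 A1 f', forall x, `|f' x - f x| <= e, 0 < d &
      forall g : X -> R, continuous g -> (forall x, `|g x - f' x| <= d) ->
      forall t mu, N mu -> (mu ((g @^-1` [set t]) `&` K) <= eta%:E)%E].
Proof.
move=> Kcl KA fU e0 eta0; have fc := let: And4 fc _ _ _ := fU in fc.
pose e' := Num.min (Num.min 1 e / 2) (eta / 2).
have e'0 : 0 < e' by rewrite !lt_min !divr_gt0// lt_min ltr01.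
have e'e : 2 * e' <= e.
  have : e' <= Num.min 1 e / 2 by rewrite ge_min lexx.
  have : Num.min 1 e <= e by rewrite ge_min lexx orbT.
  lra.
have e'1 : e' <= 1.
  have : e' <= Num.min 1 e / 2 by rewrite ge_min lexx.
  have : Num.min 1 e <= 1 by rewrite ge_min lexx.
  lra.
have e'eta : e' <= eta / 2 by rewrite ge_min lexx orbT.
have [n [V [y [VP Vf y01 KV]]]] := small_cover Kcl KA fU e'0.
have bcl i : (i < n)%N -> closed (boundary (V i)).
  move=> /VP[Vop _ _ _]; rewrite boundary_open// setDE.
  by apply: closedI; [exact: closed_closure|exact: open_closedC].
pose Z := \bigcup_(i in `I_n) boundary (V i).
have Zcl : closed Z by apply: closed_bigcup; [exact: finite_II|exact: bcl].
have Z0 mu : N mu -> mu Z = 0%E.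
  move=> Nmu; apply: measure_negligible; first exact: borel_closed.
  rewrite /Z bigcup_mkcond; apply: negligible_bigcup => i.
  case: ifPn => [|_]; last exact: negligible_set0.
  rewrite inE /= => /VP[_ _ [mb b0] _].
  by apply/negligibleP => //; exact: b0.
have [U [Uop ZU Ule]] := small_neighborhood X_compact X_metrizable N_closed
  Zcl Z0 (divr_gt0 eta0 (@ltr0Sn R 1)).
pose W i := V i `&` ~` \bigcup_(j in `I_i) closure (V j).
(* Outside [U] the set [V i] and its closure coincide: [L i] is the part of
   [W i] in [K] and outside [U], written so that it is visibly closed. *)
pose L i := K `&` ~` U `&` closure (V i) `&` ~` \bigcup_(j in `I_i) V j.
have notU i x : (i < n)%N -> ~ U x -> closure (V i) x -> V i x.
  move=> ni nUx clx; apply: contrapT => nVx; apply: nUx; apply: ZU.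
  by exists i => //; rewrite boundary_open//; have [] := VP i ni.
have LW i : (i < n)%N -> L i `<=` W i.
  move=> ni x [[[Kx nUx] clx] nV]; split; first exact: notU.
  move=> [j ji clj]; apply: nV; exists j => //.
  by apply: notU => //; exact: ltn_trans ji ni.
have Lcl i : (i < n)%N -> closed (L i).
  move=> ni; apply: closedI; first (apply: closedI; first apply: closedI => //).
  - exact: open_closedC.
  - exact: closed_closure.
  apply: open_closedC; apply: bigcup_open => j ji.
  by have [] := VP j (ltn_trans ji ni).
have Wop i : (i < n)%N -> open (W i).
  move=> ni; apply: openI; first by have [] := VP i ni.
  apply: closed_openC; apply: closed_bigcup; first exact: finite_II.
  by move=> j _; exact: closed_closure.
have Wlt i j x : W i x -> W j x -> ~ (i < j)%N.
  move=> [Vix _] [_ nj] ij; apply: nj; exists i => //.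
  exact: subset_closure.
have Wdis i j x : (i < n)%N -> (j < n)%N -> W i x -> W j x -> i = j.
  move=> _ _ Wi Wj; case: (ltngtP i j) => // ij; exfalso.
    exact: Wlt Wi Wj ij.
  exact: Wlt Wj Wi ij.
have KL x : K x -> ~ U x -> exists2 i, (i < n)%N & L i x.
  move=> Kx nUx.
  have exV : exists i, (i < n)%N && `[< V i x >].
    by have [i ni Vix] := KV x Kx; exists i; rewrite ni; exact/asboolP.
  case: (ex_minnP exV) => i /andP[ni /asboolP Vix] imin; exists i => //.
  split; first by split; [split|exact: subset_closure].
  move=> [j ji Vjx]; have := imin j; rewrite (ltn_trans ji ni)/= leqNgt ji.
  by move=> /(_ (asboolT Vjx)).
(* Starting from the minimum with [1 - e'] keeps the [c i] in [0, 1]. *)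
have [c [cy cinj]] := distinct_near_values n (fun i => Num.min (y i) (1 - e')) e'0.
have c01 i : (i < n)%N -> 0 <= c i <= 1.
  move=> ni; have /andP[y0 y1] := y01 i ni; have /andP[] := cy i ni.
  have : 0 <= Num.min (y i) (1 - e') by rewrite le_min y0 subr_ge0.
  have : Num.min (y i) (1 - e') <= 1 - e' by rewrite ge_min lexx orbT.
  by move=> *; apply/andP; split; lra.
have cyle i : (i < n)%N -> `|y i - c i| <= e'.
  move=> ni; have /andP[y0 y1] := y01 i ni; have /andP[] := cy i ni.
  rewrite ler_norml /Num.min; case: ifPn; rewrite -?leNgt => ? ? ?;
    by apply/andP; split; lra.
have LWc i : (i < n)%N -> [/\ closed (L i), open (W i), L i `<=` W i,
    W i `<=` ~` (A0 `|` A1) & 0 <= c i <= 1].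
  move=> ni; split; [exact: Lcl|exact: Wop|exact: LW| |exact: c01].
  by move=> x [Vix _]; have [_ + _ _] := VP i ni; apply.
have fWc i x : (i < n)%N -> W i x -> `|f x - c i| <= e.
  move=> ni [Vix _].
  have -> : f x - c i = (f x - y i) + (y i - c i) by rewrite addrA subrK.
  rewrite (le_trans (ler_normD _ _))//; have := cyle i ni.
  by have := Vf i x ni Vix; lra.
have [f' [f'U f'f f'L _]] := flatten_on_sets X_metrizable fU (ltW e0) LWc fWc Wdis.
have [d d0 dc] := distinct_values_gap cinj.
exists f', d; split => // g gc gf' t mu Nmu.
have gKm : @measurable _ (borel X) (g @^-1` [set t] `&` K).
  apply: measurableI; last exact: borel_closed.
  apply: borel_closed.
  by move/continuous_closedP : gc => /(_ _ (@closed_eq R t)).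
have Um : @measurable _ (borel X) U by exact: borel_open.
have [[x [[gx Kx] nUx]]|sub] := pselect (exists x, (g @^-1` [set t] `&` K) x /\ ~ U x).
  have [i ni Lx] := KL x Kx nUx; have Vim : @measurable _ (borel X) (V i).
    by apply: borel_open; have [] := VP i ni.
  apply: (@le_trans _ _ (mu (U `|` V i))).
    apply: le_measure; rewrite ?inE//; first exact: measurableU.
    move=> z [gz Kz]; have [Uz|nUz] := pselect (U z); first by left.
    right; have [j nj Lz] := KL z Kz nUz.
    suff -> : i = j by have [] := LW j nj z Lz.
    apply: dc => //; rewrite -(f'L i x)// -(f'L j z)//.
    have -> : f' x - f' z = (g z - f' z) - (g x - f' x).
      by rewrite [g z]gz [g x]gx; ring.
    by rewrite (le_trans (ler_normB _ _))//; have := gf' x; have := gf' z; lra.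
  apply: le_trans (measureU2 mu Um Vim) _.
  rewrite [eta]splitr EFinD; apply: leeD; first exact: Ule.
  have [_ _ _ Vle] := VP i ni.
  by apply: le_trans (Vle mu Nmu) _; rewrite lee_fin.
apply: (@le_trans _ _ (mu U)).
  apply: le_measure; rewrite ?inE// => z gz.
  by apply: contrapT => nUz; apply: sub; exists z.
by apply: le_trans (Ule mu Nmu) _; rewrite lee_fin; lra.
Qed.

End small_level_sets.

(** * The limit function *)

Theorem proposition2p6 (R : realType) (X : ptopologicalType)
    (X_compact : compact [set: X]) (X_metrizable : metrizable R X)
    (N : set (probability (borel X) R))
    (N_closed : closed (N : set (weak_star R X)))
    (N_atomless : forall mu, N mu -> atomless mu)
    (X_SBP : small_boundary_property N)
    (A0 A1 : set X) (A0_closed : closed A0) (A1_closed : closed A1)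
    (A01_disjoint : A0 `&` A1 = set0) :
  exists f : X -> R,
    [/\ continuous f,
        forall x, 0 <= f x <= 1,
        forall x, A0 x -> f x = 0,
        forall x, A1 x -> f x = 1
      & forall t : R, 0 <= t <= 1 ->
          small N (f @^-1` [set t] `\` (A0 `|` A1))].
Proof.
have A_closed : closed (A0 `|` A1) by exact: closedU.
have [phi [phic phi0 phiA]] := closed_zero_set X_metrizable A_closed.
pose K m := [set x | m.+1%:R^-1 <= phi x].
have Kcl m : closed (K m).
  by move/continuous_closedP : phic => /(_ _ (@closed_ge R (m.+1%:R^-1))).
have KA m : K m `<=` ~` (A0 `|` A1).
  by move=> x + /phiA; rewrite /K/= => /[swap] ->; rewrite leNgt invr_gt0 ltr0n.
have Kmono m n : (m <= n)%N -> K m `<=` K n.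
  move=> mn x; apply: le_trans.
  by rewrite lef_pV2 ?posrE// ler_nat.
have [f0 f0U] : exists f0 : X -> R, urysohn_function A0 A1 f0.
  have [|u [uc u01 u1 u0]] := bump_function X_metrizable A1_closed
    (closed_openC A0_closed).
    by move=> x A1x A0x; have : (A0 `&` A1) x by []; rewrite A01_disjoint.
  by exists u; split => // x A0x; apply: u0; exact.
(* From [p = (f, d)] the step [m] yields [q = (f', d')] such that [f'] is within
   [d / 2] of [f], and functions within [d'] of [f'] have small level sets in
   [K m]. *)
pose level_bound m (p : (X -> R) * R) := forall g : X -> R, continuous g ->
  (forall x, `|g x - p.1 x| <= p.2) ->
  forall t mu, N mu -> (mu ((g @^-1` [set t]) `&` K m) <= (m.+1%:R^-1)%:E)%E.
have [step stepP] : {step : nat * ((X -> R) * R) -> (X -> R) * R & forall mp,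
    urysohn_function A0 A1 mp.2.1 -> 0 < mp.2.2 ->
    [/\ urysohn_function A0 A1 (step mp).1,
        forall x, `|(step mp).1 x - mp.2.1 x| <= mp.2.2 / 2,
        0 < (step mp).2, (step mp).2 <= Num.min (mp.2.2 / 2) mp.1.+1%:R^-1 &
        level_bound mp.1 (step mp)]}.
  apply: (@choice _ _ (fun mp q => urysohn_function A0 A1 mp.2.1 -> 0 < mp.2.2 ->
    [/\ urysohn_function A0 A1 q.1, forall x, `|q.1 x - mp.2.1 x| <= mp.2.2 / 2,
        0 < q.2, q.2 <= Num.min (mp.2.2 / 2) mp.1.+1%:R^-1 &
        level_bound mp.1 q])) => -[m [f d]] /=.
  have [[fU d0]|nP] := pselect (urysohn_function A0 A1 f /\ 0 < d); last first.
    by exists (f, d) => fU d0; exfalso; apply: nP.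
  have d20 : 0 < d / 2 by rewrite divr_gt0.
  have m0 : 0 < m.+1%:R^-1 :> R by rewrite invr_gt0.
  have [f' [d' [f'U f'f d'0 f'level]]] := small_level_step X_compact X_metrizable
    N_closed N_atomless X_SBP A0_closed A1_closed (Kcl m) (@KA m) fU d20 m0.
  exists (f', Num.min d' (Num.min (d / 2) m.+1%:R^-1)) => _ _; split => //=.
  - by rewrite !lt_min d'0 d20 m0.
  - by rewrite ge_min lexx orbT.
  - move=> g gc /= gf'; apply: f'level => // x.
    by rewrite (le_trans (gf' x))// ge_min lexx.
pose s := fix s m := if m is k.+1 then step (k, s k) else (f0, 1).
have sP m : urysohn_function A0 A1 (s m).1 /\ 0 < (s m).2.
  elim: m => [|m [IHU IH0]]; first by split => //=; exact: ltr01.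
  by have [] := stepP (m, s m) IHU IH0.
have sS m := stepP (m, s m) (sP m).1 (sP m).2.
have s_close m k x : `|(s (m + k)%N).1 x - (s m).1 x| <= (s m).2 - (s (m + k)%N).2.
  elim: k => [|k IHk]; first by rewrite addn0 !subrr normr0.
  rewrite addnS; have [_ /(_ x) /= close _ + _] := sS (m + k)%N.
  rewrite le_min => /andP[/= half _].
  have := ler_distD ((s (m + k)%N).1 x) ((s (m + k).+1).1 x) ((s m).1 x).
  by rewrite /= in IHk close half *; lra.
(* The intervals of center [(s m).1 x] and radius [(s m).2] are nested; their
   common point [f x] is the supremum of their left ends. *)
pose S x := [set (s m).1 x - (s m).2 | m in [set: nat]].
pose f x := sup (S x).
have Sub x n : ubound (S x) ((s n).1 x + (s n).2).
  move=> _ [m _ <-]; have [mn|/ltnW nm] := leqP m n.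
    have := s_close m (n - m)%N x; rewrite subnKC// ler_norml => /andP[+ _].
    by have := (sP n).2; lra.
  have := s_close n (m - n)%N x; rewrite subnKC// ler_norml => /andP[_].
  by have := (sP m).2; lra.
have f_close n x : `|f x - (s n).1 x| <= (s n).2.
  rewrite ler_norml; apply/andP; split.
    rewrite lerBrDl; apply: ub_le_sup; last by exists n.
    by exists ((s n).1 x + (s n).2); exact: Sub.
  rewrite lerBlDl; apply: ge_sup; last exact: Sub.
  by exists ((s n).1 x - (s n).2), n.
have s_small e : 0 < e -> exists n, (s n).2 < e.
  move=> e0; exists (Num.truncn e^-1).+1; have [_ _ _ /= + _] := sS (Num.truncn e^-1).
  rewrite le_min => /andP[_] /le_lt_trans; apply.
  by rewrite invf_plt ?posrE// truncnS_gt.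
have fc : continuous f.
  move=> x; apply/cvgrPdist_lt => e e0.
  have [n sn] := s_small (e / 3) (divr_gt0 e0 (@ltr0Sn R 2)).
  have [[snc _ _ _] _] := sP n; have /cvgrPdist_lt snx := snc x.
  near=> y.
  have fx := f_close n x; have fy := f_close n y.
  have sxy : `|(s n).1 x - (s n).1 y| < e / 3.
    by near: y; apply: snx; rewrite divr_gt0.
  move: fx fy sxy; rewrite !ler_norml !ltr_norml => /andP[? ?] /andP[? ?] /andP[? ?].
  by apply/andP; split; lra.
have f_eq x (c : R) : (forall n, (s n).1 x = c) -> f x = c.
  move=> sc; apply/eqP; rewrite -subr_eq0 -normr_le0; apply/ler_addgt0Pr => e e0.
  have [n sn] := s_small e e0; rewrite add0r.
  by have := f_close n x; rewrite sc => /le_trans -> //; exact: ltW.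
exists f; split => //.
- move=> x; apply/andP; split; apply/ler_addgt0Pr => e e0;
    have [n sn] := s_small e e0; have [[_ /(_ x)/andP[? ?] _ _] _] := sP n;
    by have := f_close n x; rewrite ler_norml => /andP[? ?]; lra.
- by move=> x A0x; apply: f_eq => n; have [[_ _ + _] _] := sP n; apply.
- by move=> x A1x; apply: f_eq => n; have [[_ _ _ +] _] := sP n; apply.
move=> t _; have ftcl : closed (f @^-1` [set t]).
  by move/continuous_closedP : fc => /(_ _ (@closed_eq R t)).
have ftm : @measurable _ (borel X) (f @^-1` [set t] `\` (A0 `|` A1)).
  by apply: measurableD; exact: borel_closed.
split => // mu Nmu; apply: measure_negligible => //.
have -> : f @^-1` [set t] `\` (A0 `|` A1) = \bigcup_m (f @^-1` [set t] `&` K m).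
  apply/seteqP; split=> [x [fx nAx]|x [m _ [fx /KA nAx]]]; last by split.
  have phix : 0 < phi x.
    by rewrite lt_neqAle phi0 andbT eq_sym; apply/eqP => /phiA.
  exists (Num.truncn (phi x)^-1) => //; split => //; rewrite /K/= ltW//.
  by rewrite invf_plt ?posrE// truncnS_gt.
apply: negligible_bigcup => m.
have fKm n : @measurable _ (borel X) (f @^-1` [set t] `&` K n).
  by apply: borel_closed; exact: closedI.
apply/negligibleP => //; apply/eqP; rewrite eq_le measure_ge0 andbT.
apply/lee_addgt0Pr => e e0; rewrite add0e.
pose n := maxn m (Num.truncn e^-1).
have level : (mu (f @^-1` [set t] `&` K n) <= (n.+1%:R^-1)%:E)%E.
  by have [_ _ _ _ /= lvl] := sS n; apply: lvl => // x; exact: (f_close n.+1).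
apply: le_trans (le_trans level _).
  apply: le_measure; rewrite ?inE//.
  by move=> x [fx Kx]; split => //; apply: Kmono Kx; exact: leq_maxl.
rewrite lee_fin invf_ple ?posrE// ltW// (lt_le_trans (truncnS_gt _))//.
by rewrite ler_nat ltnS leq_maxr.
Unshelve. all: by end_near. Qed.
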